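(* Let $N$ be prime, and pick any $M\leq N$ rows of the $N\times N$ discrete Fourier transform matrix to form the $M\times N$ matrix $H$. Next, pick any $K\leq M$, and take $D$ to be the $M\times M$ diagonal matrix whose first $K$ diagonal entries are $\sqrt{\frac{N+K-M}{MN}}$, and whose remaining $M-K$ diagonal entries are $\sqrt{\frac{N+K}{MN}}$. Then concatenating $DH$ with the first $K$ identity basis elements of $\mathbb{C}^M$ produces an $M\times(N+K)$ full spark unit norm tight frame.
   Context: The $N\times N$ discrete Fourier transform matrix is scaled to have unimodular entries: its $(m,n)$ entry is $\omega^{mn}$, $m,n\in\{0,\dots,N-1\}$, with $\omega=e^{-2\pi \mathrm{i}/N}$. Here $M\ge1$ and $K\ge0$ are integers. An $M\times P$ matrix with $P\ge M$ is full spark if every $M\times M$ submatrix (formed by $M$ distinct columns) is invertible. A unit norm tight frame is an $M\times P$ matrix of rank $M$ whose columns have unit norm and whose rows are pairwise orthogonal with equal norms. *)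

(* Defs.v *)
From HB Require Import structures.
From mathcomp Require Import all_boot all_order all_algebra.
From mathcomp Require Import reals trigo.
From mathcomp Require Import complex.
Set Implicit Arguments.
Unset Strict Implicit.
Unset Printing Implicit Defensive.
Import Order.TTheory GRing.Theory Num.Theory.
Local Open Scope ring_scope.
Local Open Scope complex_scope.

Definition cis (R : realType) (t : R) : R[i] := cos t +i* sin t.

(* The rows and columns are indexed from 0, so no shift is needed in the
   exponent. *)
Definition dft_mx (R : realType) (N : nat) : 'M[R[i]]_N :=
  \matrix_(m, n) cis (- (2 * pi / N%:R)) ^+ (m * n).

Definition norm2 (R : realType) (n : nat) (u : 'rV[R[i]]_n) : R[i] :=
  sqrtC (dotmx u u).

(* Injectivity of f makes the M selected columns distinct; they may appear in
   any order. *)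
Definition full_spark (R : realType) (M P : nat) (A : 'M[R[i]]_(M, P)) : Prop :=
  (M <= P)%N /\
  forall f : 'I_M -> 'I_P, injective f -> colsub f A \in unitmx.

Definition unit_norm_tight_frame (R : realType) (M P : nat)
    (A : 'M[R[i]]_(M, P)) : Prop :=
  [/\ \rank A = M,
      forall j : 'I_P, norm2 (col j A)^T = 1,
      forall i i' : 'I_M, i != i' -> dotmx (row i A) (row i' A) = 0
    & forall i i' : 'I_M, norm2 (row i A) = norm2 (row i' A)].

(* Num.sqrt vanishes on negative reals; the first radicand is nonnegative as
   soon as M <= N. *)
Definition diag_scaling (R : realType) (M N K : nat) : 'M[R[i]]_M :=
  diag_mx (\row_i (if (i < K)%N
                   then Num.sqrt ((N%:R + K%:R - M%:R) / (M%:R * N%:R))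
                   else Num.sqrt ((N%:R + K%:R) / (M%:R * N%:R)))%:C).

(* The columns of the identity matrix form the standard basis. *)
Definition first_basis (R : realType) (M K : nat) (KM : (K <= M)%N) :
    'M[R[i]]_(M, K) :=
  colsub (widen_ord KM) 1%:M.

(* Main.v *)
Require Import Defs.
From mathcomp Require Import all_boot all_order all_algebra.
From mathcomp Require Import reals trigo.
From mathcomp Require Import complex.
From mathcomp Require Import ring.
Import Order.TTheory GRing.Theory Num.Theory.
Local Open Scope ring_scope.

(** Tightness is a computation: distinct rows of the DFT matrix are orthogonal
    (a geometric sum of a nontrivial root of unity), and the two scalings in D
    are exactly those for which every row of the frame has squared norm
    (N + K) / M and every column has norm 1.

    Full spark rests on Chebotarev's theorem ([chebotarev_unitmx]): when N is
    prime, all the square submatrices of the DFT matrix are invertible.  A row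
    vector v that annihilates M columns of the frame vanishes at the index of
    each basis vector among them, so v D has at most as many nonzero entries as
    there are DFT columns among the M, and it annihilates these columns.
    Chebotarev's theorem forces v D = 0 ([prim_root_uncertainty]), hence v = 0,
    D being invertible.

    Chebotarev's theorem, for a primitive p-th root of unity w, is proved in
    two steps.  Write the matrix of the w^(r_i s_j) as that of the values of
    the monomials T^(s_j) at the nodes X^(r_i), specialised at X = w, and
    expand each monomial in the Newton basis of these nodes over Z[X].  This
    factors the matrix as L C, where L is triangular, with diagonal entries
    prod_(l < i) (X^(r_i) - X^(r_l)), and C is the matrix of the Newton
    coefficients.  At X = w, det L is nonzero since the w^(r_i) are distinct.
    At X = 1 all the nodes become 1 and Newton's expansion becomes Taylor's
    expansion at 1, so that C becomes the matrix of the binomial coefficients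
    C(s_j, k), whose determinant is nonzero modulo p, being a Vandermonde
    determinant up to factorials ([det_binom_Fp_neq0]).

    It remains to see that det C, an integer polynomial Q whose value at 1 is
    nonzero modulo p, cannot vanish at w.  This is [horner1_Fp_eq0]: w would be
    a root of a common factor of Q and X^p - 1 in Z[X]; modulo p the latter is
    (X - 1)^p, so this factor, hence Q, would vanish at 1 modulo p. *)

(** * Integer polynomials vanishing at a root of unity of prime order *)

Lemma XpolyB1_Fp (p : nat) (p_pr : prime p) :
  'X^p - 1 = ('X - 1%:P) ^+ p :> {poly 'F_p}.
Proof.
have chX : p \in [pchar {poly 'F_p}] by rewrite pchar_poly pchar_Fp.
by rewrite -!(pFrobenius_autE chX) rmorphB /= polyC1 rmorph1.
Qed.

(** The rational gcd of [Q] and X^p - 1 is, by Gauss's lemma, a nonzero rational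
    multiple of some [g] in Z[X] that divides X^p - 1 there.  The leading
    coefficient of [g] is then a unit, so [g] keeps its degree modulo [p] and
    divides [Q] over Z. As [g] vanishes at [w] it is not constant, so its
    reduction, a factor of (X - 1)^p, has the root 1. *)
Lemma horner1_Fp_eq0 {F : numFieldType} {p : nat} {w : F} {Q : {poly int}} :
  prime p -> w ^+ p = 1 -> (map_poly intr Q).[w] = 0 ->
  (Q.[1])%:~R = 0 :> 'F_p.
Proof.
move=> p_pr wp1 Qw0.
pose toQ := map_poly (intr : int -> rat).
have p_gt0 := prime_gt0 p_pr.
have Xp1_neq0 : toQ ('X^p - 1) != 0.
  by rewrite /toQ rmorphB /= map_polyXn rmorph1 monic_neq0 // monicXnsubC.
pose G := gcdp (toQ Q) (toQ ('X^p - 1)).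
have [g [a a_neq0 defG] [r defXp]] : {g : {poly int} &
    {a : rat | a != 0 & G = a *: toQ g} & {r | 'X^p - 1 = g * r}}.
  exact: dvdpP_rat_int (dvdp_gcdr _ _).
have G_neq0 : G != 0 by rewrite gcdp_eq0 negb_and Xp1_neq0 orbT.
have toF q : map_poly ratr (toQ q) = map_poly intr q :> {poly F}.
  by rewrite -map_poly_comp; apply: eq_map_poly => z /=; rewrite ratr_int.
have Gw : root (map_poly ratr G) w.
  rewrite gcdp_map root_gcd !toF /root Qw0 eqxx /=.
  by rewrite rmorphB /= map_polyXn rmorph1 !hornerE wp1 subrr.
have size_g : (1 < size g)%N.
  have := root_size_gt1 _ Gw; rewrite map_poly_eq0 => /(_ G_neq0).
  rewrite size_map_poly defG size_scale // size_map_inj_poly //.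
  exact: intr_inj.
have lg_unit : lead_coef g \is a GRing.unit.
  apply/unitrPr; exists (lead_coef r); rewrite -lead_coefM -defXp.
  by rewrite lead_coefXnsubC.
have lead_neq0 (A : nzRingType) : (lead_coef g)%:~R != 0 :> A.
  have [u ug] := unitrPr lg_unit.
  apply: contraTneq (oner_neq0 A) => g0.
  by rewrite -(rmorph1 intr) -ug rmorphM /= g0 mul0r eqxx.
(* Division by [g] is Euclidean over Z, and [g] divides [Q] over the rationals,
   so the remainder is zero. *)
have g_dvd_Q : g %| Q.
  rewrite /dvdp -[_ == 0](inj_eq (map_inj_poly (@intr_inj rat) (rmorph0 _))).
  rewrite rmorph0.
  apply: contraT => rem_neq0.
  have: toQ g %| toQ (Q %% g).
    have : toQ g %| toQ Q.
      by rewrite -(dvdpZl _ _ a_neq0) -defG dvdp_gcdl.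
    rewrite {1}(Pdiv.IdomainUnit.divp_eq lg_unit Q) /toQ rmorphD rmorphM /=.
    by rewrite dvdp_addr // dvdp_mull.
  move/(dvdp_leq rem_neq0).
  rewrite !size_map_inj_poly //; try exact: intr_inj.
  rewrite leqNgt ltn_modp -size_poly_gt0 (ltn_trans _ size_g) //=.
pose toFp := map_poly (intr : int -> 'F_p).
have size_gp : size (toFp g) = size g by exact: size_map_poly_id0 (lead_neq0 _).
have : toFp g %| ('X - 1%:P) ^+ p.
  rewrite -XpolyB1_Fp // -(map_polyXn intr) -(rmorph1 toFp) -rmorphB /=.
  by rewrite defXp rmorphM dvdp_mulIl.
case/dvdp_exp_XsubCP=> k _ gk.
have k_gt0 : (0 < k)%N.
  by rewrite -ltnS -(size_exp_XsubC k (1 : 'F_p)) -(eqp_size gk) size_gp.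
have g1 : root (toFp g) 1.
  by rewrite (eqp_root gk) /root horner_exp hornerXsubC subrr expr0n gtn_eqF.
have [q ->] := Pdiv.IdomainUnit.dvdpP lg_unit Q g_dvd_Q.
rewrite hornerM rmorphM /= -[X in _ * X]horner_map /= rmorph1.
by rewrite (eqP g1) mulr0.
Qed.

(** * Newton interpolation *)

(** The factors 'X - x_l are monic, so repeated synthetic division gives the
    expansion over any commutative ring. Keeping the last term (with factor [g])
    makes the identity one of polynomials, which ring morphisms preserve. *)
Lemma newton_expansion {A : comNzRingType} (m : nat) (x : nat -> A)
    (f : {poly A}) :
  exists (c : nat -> A) (g : {poly A}),
    f = \sum_(k < m) c k *: \prod_(l < k) ('X - (x l)%:P)
        + \prod_(l < m) ('X - (x l)%:P) * g.
Proof.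
elim: m x f => [|m IHm] x f.
  by exists (fun=> 0), f; rewrite !big_ord0 mul1r add0r.
have /factor_theorem[q defq] : root (f - f.[x 0%N]%:P) (x 0%N).
  by rewrite /root !hornerE subrr.
have [c [g defg]] := IHm (x \o succn) q.
exists (fun k => if k is k'.+1 then c k' else f.[x 0%N]), g.
rewrite -[LHS](subrK f.[x 0%N]%:P) defq {1}defg.
rewrite !big_ord_recl /= big_ord0 alg_polyC addrC mulrDl mulr_suml -addrA.
congr (_ + (_ + _)); last by rewrite mulrC mulrA.
by apply: eq_bigr => k _; rewrite big_ord_recl -scalerAl mulrC.
Qed.

(** Once the nodes are sent to 1, the Newton expansion is that in the powers
    of 'X - 1; composing it with 'X + 1 exhibits the [h (c k)] as the first [m]
    coefficients of ('X + 1)^s. *)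
Lemma newton_coef_Xn {A B : comNzRingType} (h : {rmorphism A -> B})
    {m s : nat} {x c : nat -> A} {g : {poly A}} :
    (forall l, h (x l) = 1) ->
    'X^s = \sum_(k < m) c k *: \prod_(l < k) ('X - (x l)%:P)
           + \prod_(l < m) ('X - (x l)%:P) * g ->
  forall k, (k < m)%N -> h (c k) = 'C(s, k)%:R.
Proof.
move=> hx defXs k km.
have shiftX n : (\prod_(l < n) map_poly h ('X - (x l)%:P)) \Po ('X + 1) = 'X^n.
  under eq_bigr do rewrite rmorphB /= map_polyX map_polyC /= hx.
  rewrite prodr_const card_ord rmorphXn rmorphB /=.
  by rewrite comp_polyX comp_polyC addrK.
have := congr1 (fun q => (map_poly h q \Po ('X + 1))`_k) defXs.
rewrite rmorphD rmorphM !rmorph_sum /= rmorph_prod /=.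
rewrite comp_polyD comp_polyM shiftX.
rewrite map_polyXn comp_Xn_poly coefD coefXnM km addr0.
rewrite (_ : ('X + 1) ^+ s = \poly_(i < s.+1) 'C(s, i)%:R); last first.
  rewrite addrC exprDn poly_def; apply: eq_bigr => i _.
  by rewrite expr1n mul1r scaler_nat.
rewrite coef_poly linear_sum /= coef_sum (bigD1 (Ordinal km)) //.
have termE (i : 'I_m) :
    (map_poly h (c i *: \prod_(l < i) ('X - (x l)%:P)) \Po ('X + 1))`_k
    = h (c i) * (k == i)%:R.
  by rewrite map_polyZ linearZ /= rmorph_prod shiftX coefZ coefXn.
rewrite termE eqxx mulr1 big1 => [|i ik]; last first.
  by rewrite termE eq_sym (negbTE (ik : (i : nat) != k)) mulr0.
by rewrite Monoid.mulm1 => <-; case: ltnP => // sk; rewrite bin_small.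
Qed.

(** * Chebotarev's theorem on the minors of the Fourier matrix *)

(** Scaling the k-th row by k! turns it into the values at the [s j] of the
    falling factorial of degree k. These polynomials being monic of degrees
    0, ..., m - 1, a unitriangular matrix [T] relates them to the monomials,
    hence the scaled determinant to the Vandermonde determinant of the [s j],
    which are distinct modulo [p]. *)
Lemma det_binom_Fp_neq0 {p m : nat} {s : 'I_m -> 'I_p} :
    prime p -> injective s ->
  \det (\matrix_(k < m, j < m) 'C(s j, k)%:R : 'M['F_p]_m) != 0.
Proof.
move=> p_pr s_inj.
pose P k : {poly 'F_p} := \prod_(l < k) ('X - l%:R%:P).
have P_size k : size (P k) = k.+1.
  by rewrite size_prod_XsubC /= /index_enum -enumT size_enum_ord.
have P_val k (n : nat) : (P k).[n%:R] = (k`! * 'C(n, k))%:R.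
  rewrite horner_prod mulnC bin_ffact.
  elim: k => [|k IHk]; first by rewrite big_ord0 ffactn0.
  rewrite big_ord_recr IHk /= !hornerE ffactnSr natrM.
  (* Truncated subtraction is harmless: both sides vanish when n < k. *)
  case: (leqP k n) => [kn|nk]; first by rewrite natrB.
  by rewrite ffact_small // !mul0r.
pose T : 'M['F_p]_m := \matrix_(k, l) (P k)`_l.
pose V := Vandermonde m (\row_(j < m) (s j)%:R : 'rV['F_p]_m).
pose B : 'M['F_p]_m := \matrix_(k < m, j < m) 'C(s j, k)%:R.
have TV : T *m V = diag_mx (\row_k (k`!)%:R) *m B.
  apply/matrixP => k j; rewrite mul_diag_mx !mxE -natrM -P_val.
  rewrite (@horner_coef_wide _ m) ?P_size //.
  by apply: eq_bigr => l _; rewrite !mxE.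
have detT : \det T = 1.
  rewrite det_trig; last first.
    apply/is_trig_mxP => k l kl; rewrite mxE nth_default //.
    by rewrite P_size.
  apply: big1 => k _; rewrite mxE.
  have := monic_prod_XsubC (index_enum 'I_k) predT
    (fun l : 'I_k => l%:R : 'F_p).
  by rewrite qualifE /= lead_coefE P_size => /eqP.
have : \det (T *m V) != 0.
  rewrite det_mulmx detT mul1r det_Vandermonde.
  apply/prodf_neq0 => i _; apply/prodf_neq0 => j ij; rewrite !mxE subr_eq0.
  apply: contraTneq ij => /eqP.
  rewrite -(inj_eq val_inj) /= !val_Fp_nat // !modn_small //.
  by rewrite (inj_eq val_inj) (inj_eq s_inj) => /eqP->; rewrite ltnn.
by rewrite TV det_mulmx mulf_eq0 negb_or => /andP[].
Qed.

(** Chebotarev's theorem: Newton interpolation factors the matrix. The first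
    factor is triangular, with products of differences of distinct powers of [w]
    on the diagonal; the determinant of the second is an integer polynomial in
    [w] whose value at 1, a determinant of binomials, is nonzero modulo [p]. *)
Theorem chebotarev_unitmx {F : numFieldType} {p m : nat} {w : F}
    {r s : 'I_m -> 'I_p} :
    prime p -> p.-primitive_root w -> injective r -> injective s ->
  \matrix_(i < m, j < m) w ^+ (r i * s j) \in unitmx.
Proof.
move=> p_pr w_prim r_inj s_inj.
(* Nodes are indexed by all naturals; those out of range only have to take the
   value 1 at 1, as the others do. *)
have [x xE x1] : exists2 x : nat -> {poly int},
    forall i : 'I_m, x i = 'X^(r i) & forall l, (x l).[1] = 1.
  exists (fun l => if insub l is Some i then 'X^(r i) else 1) => [i|l].
    by rewrite valK.
  by case: insub => [i|]; rewrite ?hornerXn ?hornerC ?expr1n.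
have [c] := fin_all_exists (fun j : 'I_m => newton_expansion m x 'X^(s j)).
case/fin_all_exists=> g defX.
pose C : 'M[{poly int}]_m := \matrix_(k, j) c j k.
pose L : 'M[{poly int}]_m := \matrix_(i, k) \prod_(l < k) (x i - x l).
pose ev : {rmorphism {poly int} -> F} := horner_eval w \o map_poly intr.
have LC : \matrix_(i < m, j < m) 'X^(r i) ^+ s j = L *m C.
  apply/matrixP=> i j; rewrite !mxE -xE -hornerXn [in LHS](defX j).
  rewrite hornerD hornerM !horner_prod.
  rewrite [\prod_(l < m) _](bigD1 i) //= hornerXsubC subrr.
  rewrite !mul0r addr0 horner_sum; apply: eq_bigr => k _.
  rewrite !mxE hornerZ horner_prod mulrC; congr (_ * _).
  by apply: eq_bigr => l _; rewrite hornerXsubC.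
have evX n : ev 'X^n = w ^+ n.
  by rewrite /ev /= map_polyXn /horner_eval hornerXn.
have -> : \matrix_(i < m, j < m) w ^+ (r i * s j) = map_mx ev (L *m C).
  by rewrite -LC; apply/matrixP=> i j; rewrite !mxE -exprM evX.
rewrite unitmxE map_mxM det_mulmx unitfE mulf_neq0 //.
  rewrite det_trig; last first.
    apply/is_trig_mxP => i k ik; rewrite !mxE (bigD1 (Ordinal ik)) //=.
    by rewrite subrr mul0r; exact: (rmorph0 ev).
  apply/prodf_neq0 => i _; rewrite mxE mxE rmorph_prod.
  apply/prodf_neq0 => l _.
  have lm : (l < m)%N by apply: ltn_trans (ltn_ord i).
  rewrite xE (xE (Ordinal lm)) rmorphB !evX.
  rewrite subr_eq0 (eq_prim_root_expr w_prim) !modn_small //.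
  rewrite (inj_eq val_inj) (inj_eq r_inj) -(inj_eq val_inj) /=.
  by rewrite gtn_eqF.
rewrite det_map_mx; apply: contraNneq (det_binom_Fp_neq0 p_pr s_inj).
move/(horner1_Fp_eq0 p_pr (prim_expr_order w_prim)) => detC1.
pose h : {rmorphism {poly int} -> 'F_p} := intr \o horner_eval 1.
rewrite -[X in X == _](_ : h (\det C) = _); first exact/eqP.
rewrite -det_map_mx; congr (\det _); apply/matrixP=> k j; rewrite !mxE.
apply: (newton_coef_Xn h _ (defX j)) => // l.
by rewrite /h /= /horner_eval x1.
Qed.

(** The uncertainty principle over a field of prime order: a nonzero function
    cannot have a Fourier transform with at least as many zeros as the function
    has nonzero values.  Restricting to the support of [u] and to as many points
    of [B] leaves a square system, which Chebotarev's theorem solves. *)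
Lemma prim_root_uncertainty {F : numFieldType} {p : nat} {w : F} {I : finType}
    {r : I -> 'I_p} {u : I -> F} {B : {set 'I_p}} :
    prime p -> p.-primitive_root w -> injective r ->
    (#|[set i | u i != 0%R]| <= #|B|)%N ->
    (forall j, j \in B -> \sum_i u i * w ^+ (r i * j) = 0) ->
  forall i, u i = 0.
Proof.
move=> p_pr w_prim r_inj; set A := [set i | _] => leAB u_orth.
pose a (k : 'I_#|A|) := r (enum_val k).
pose b (k : 'I_#|A|) := enum_val (widen_ord leAB k).
have a_inj : injective a by move=> k l /r_inj/enum_val_inj.
have b_inj : injective b.
  by move=> k l /enum_val_inj/(congr1 val)/= ekl; exact: val_inj.
have W_unit := chebotarev_unitmx p_pr w_prim a_inj b_inj.
have v0 : \row_k u (enum_val k) = 0 :> 'rV_#|A|.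
  apply: (can_inj (mulmxK W_unit)); rewrite mul0mx.
  apply/rowP=> l; rewrite !mxE -[RHS](u_orth (b l)) ?enum_valP //.
  rewrite [RHS](bigID (mem A)) /= addrC.
  rewrite [X in _ = X + _]big1 ?add0r => [|i]; last first.
    by rewrite inE negbK => /eqP->; rewrite mul0r.
  by rewrite [RHS]big_enum_val; apply: eq_bigr => k _; rewrite !mxE.
move=> i; apply/eqP/negPn/negP => ui_neq0.
have iA : i \in A by rewrite inE.
have /rowP/(_ (enum_rank_in iA i)) := v0.
by rewrite !mxE enum_rankK_in // => /eqP; rewrite (negbTE ui_neq0).
Qed.

(** * Roots of unity and orthogonality *)

Lemma cisD (R : realType) (s t : R) : cis (s + t) = cis s * cis t.
Proof.
by apply/eqP; rewrite eq_complex /= cosD sinD [sin s * _ + _]addrC !eqxx.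
Qed.

Lemma cisMn (R : realType) (t : R) (n : nat) : cis (t *+ n) = cis t ^+ n.
Proof.
elim: n => [|n IHn]; first by rewrite mulr0n /cis cos0 sin0.
by rewrite mulrS cisD IHn exprS.
Qed.

(** For [N] prime it is enough that the root of unity is not 1; its real part is
    1 - 2 sin(pi / N)^2, with 0 < pi / N < pi. *)
Lemma cis_primitive_root (R : realType) (N : nat) :
  prime N -> N.-primitive_root (cis (- (2 * pi / N%:R)) : R[i]).
Proof.
move=> N_pr; have N_gt1 := prime_gt1 N_pr; have N_gt0 := ltnW N_gt1.
set t : R := - _; set w := cis t.
have tE : t = - (pi / N%:R *+ 2) by rewrite /t mulr_natl mulrnAl.
have wN1 : w ^+ N = 1.
  rewrite -cisMn tE mulNrn -mulrnA mulnC mulrnA -[_ *+ N]mulr_natr.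
  rewrite divfK ?pnatr_eq0 -?lt0n //.
  by rewrite /cis cosN sinN cos2pi sin2pi oppr0.
have w_neq1 : w != 1.
  apply/eqP => /(congr1 (@complex.Re R)) /=; rewrite tE cosN cos_mulr2n.
  have : 0 < sin (pi / N%:R : R).
    apply: sin_gt0_pi; rewrite divr_gt0 ?pi_gt0 ?ltr0n //=.
    by rewrite ltr_pdivrMr ?ltr0n // ltr_pMr ?pi_gt0 // ltr1n.
  move=> s_gt0; rewrite -[1]/(1 : R) => c2.
  have := cos2Dsin2 (pi / N%:R : R).
  have /eqP -> : cos (pi / N%:R : R) ^+ 2 == 1.
    rewrite -(inj_eq (pmulrnI (ltn0Sn 1))) -(inj_eq (addIr (- 1))) c2.
    by rewrite mulr2n addrK.
  move/eqP; rewrite -subr_eq0 addrAC subrr add0r expf_eq0 /=.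
  by rewrite gt_eqF.
have [m w_prim mN] := prim_order_exists N_gt0 wN1.
have [_ /(_ m mN)/orP[/eqP m1|/eqP <- //]] := primeP N_pr.
move: (prim_expr_order w_prim); rewrite m1 expr1 => /eqP.
by rewrite (negbTE w_neq1).
Qed.

Lemma norm_unity_root {C : numClosedFieldType} {n : nat} {w : C} :
  (0 < n)%N -> w ^+ n = 1 -> `|w| = 1.
Proof.
move=> n_gt0 wn1; apply/eqP.
by rewrite -(pexpr_eq1 n_gt0) // -normrX wn1 normr1.
Qed.

(** The sum is geometric with ratio z = w^i / w^i', where z^n = 1 and z is not
    1. *)
Lemma prim_root_orthogonal {C : numClosedFieldType} {n : nat} {w : C}
    (i i' : 'I_n) : n.-primitive_root w -> i != i' ->
  \sum_(j < n) w ^+ (i * j) * (w ^+ (i' * j))^* = 0.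
Proof.
move=> w_prim neq_ii'.
have wn1 := prim_expr_order w_prim.
have nw := norm_unity_root (prim_order_gt0 w_prim) wn1.
have w_neq0 : w != 0 by rewrite -normr_eq0 nw oner_eq0.
have cw : w^* = w^-1 by rewrite invC_norm nw expr1n invr1 mul1r.
pose z := w ^+ i / w ^+ i'.
have zE (j : 'I_n) : w ^+ (i * j) * (w ^+ (i' * j))^* = z ^+ j.
  by rewrite rmorphXn /= cw /z exprMn !exprVn -!exprM.
have z_neq1 : z - 1 != 0.
  rewrite subr_eq0 /z -(inj_eq (mulIf (expf_neq0 i' w_neq0))).
  rewrite divfK ?expf_neq0 //.
  by rewrite mul1r (eq_prim_root_expr w_prim) !modn_small.
apply: (mulfI z_neq1); rewrite (eq_bigr _ (fun j _ => zE j)) -subrX1 mulr0.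
rewrite /z exprMn !exprVn -!exprM ![(_ * n)%N]mulnC !exprM wn1.
by rewrite !expr1n invr1 mulr1 subrr.
Qed.

(** * Full spark *)

(** Given [M] selected columns, [S] is the set of the Fourier columns and [T]
    that of the basis vectors among them. A row vector killing these columns
    vanishes on [T], so its support has at most #|S| elements. *)
Lemma full_spark_dft_first_basis (R : realType) (N M K : nat) (d : 'rV[R[i]]_M)
    (r : 'I_M -> 'I_N) (K_le_M : (K <= M)%N) :
    prime N -> injective r -> (forall i, d 0 i != 0) ->
  full_spark
    (row_mx (diag_mx d *m rowsub r (dft_mx R N)) (first_basis R K_le_M)).
Proof.
move=> N_pr r_inj d_neq0.
have M_le_N : (M <= N)%N by have := leq_card r r_inj; rewrite !card_ord.
split=> [|f f_inj]; first exact: leq_trans M_le_N (leq_addr _ _).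
rewrite -row_free_unit; apply: inj_row_free => v.
rewrite mulmx_colsub => /rowP vf0.
pose S := [set j | [exists k, f k == lshift K j]].
pose T := [set t | [exists k, f k == rshift N t]].
have vT t : t \in T -> v 0 (widen_ord K_le_M t) = 0.
  rewrite inE => /existsP[k /eqP fk]; have := vf0 k.
  rewrite mul_mx_row mxE [RHS]mxE fk row_mxEr mxE.
  rewrite (bigD1 (widen_ord K_le_M t)) //=.
  rewrite !mxE eqxx mulr1 big1 ?addr0 // => i neq_it.
  by rewrite !mxE (negbTE neq_it) mulr0.
have vS j : j \in S ->
    \sum_i (v 0 i * d 0 i) * cis (- (2 * pi / N%:R)) ^+ (r i * j) = 0.
  rewrite inE => /existsP[k /eqP fk]; have := vf0 k.
  rewrite mul_mx_row mxE [RHS]mxE fk row_mxEl mulmxA mxE => vHj.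
  rewrite -[RHS]vHj.
  by apply: eq_bigr => i _; rewrite mul_mx_diag !mxE.
have cardST : (M <= #|S| + #|T|)%N.
  rewrite -[M in (M <= _)%N]card_ord -(card_imset predT f_inj).
  rewrite -(card_imset S (@lshift_inj N K)) -(card_imset T (@rshift_inj N K)).
  apply: leq_trans (leq_card_setU _ _); apply/subset_leq_card/subsetP.
  move=> _ /imsetP[k _ ->].
  rewrite inE; case: (split_ordP (f k)) => j fk; rewrite fk.
    by rewrite imset_f // inE; apply/existsP; exists k; rewrite fk.
  by rewrite orbC imset_f // inE; apply/existsP; exists k; rewrite fk.
have card_supp : (#|[set i | (v 0 i * d 0 i != 0)%R]| <= #|S|)%N.
  have widen_inj : injective (widen_ord K_le_M).
    by move=> t t' /(congr1 val)/= ett'; exact: val_inj.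
  rewrite -(leq_add2r #|T|); apply: leq_trans cardST.
  rewrite -(card_imset T widen_inj) -[X in (_ <= X)%N]card_ord.
  rewrite -(cardC (mem (widen_ord K_le_M @: T))) addnC leq_add2l.
  apply/subset_leq_card/subsetP => i.
  rewrite !inE mulf_eq0 negb_or => /andP[vi _].
  by apply: contra vi => /imsetP[t tT ->]; rewrite vT.
have w_prim := cis_primitive_root R N N_pr.
have vd0 := prim_root_uncertainty N_pr w_prim r_inj card_supp vS.
apply/rowP=> i; rewrite mxE; apply/eqP; have /eqP := vd0 i.
by rewrite mulf_eq0 (negbTE (d_neq0 i)) orbF.
Qed.

(** * The scaling factors *)

Definition row_scale (R : realType) (M N K i : nat) : R :=
  if (i < K)%N then Num.sqrt ((N%:R + K%:R - M%:R) / (M%:R * N%:R))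
  else Num.sqrt ((N%:R + K%:R) / (M%:R * N%:R)).

(** The two cases in one formula, so that sums over the rows split. *)
Lemma row_scaleE (R : realType) (M N K i : nat) :
  row_scale R M N K i
  = Num.sqrt ((N%:R + K%:R - M%:R *+ (i < K)%N) / (M%:R * N%:R)).
Proof. by rewrite /row_scale; case: ifP; rewrite ?subr0. Qed.

Lemma row_scale_radicand_gt0 (R : realType) (M N K i : nat) :
    (0 < M)%N -> (M <= N)%N ->
  0 < (N%:R + K%:R - M%:R *+ (i < K)%N) / (M%:R * N%:R) :> R.
Proof.
move=> M_gt0 M_le_N; have N_gt0 := leq_trans M_gt0 M_le_N.
rewrite divr_gt0 ?mulr_gt0 ?ltr0n // subr_gt0 -natrD -mulrnA ltr_nat.
case: (ltnP i K) => [iK|_]; last by rewrite /= muln0 addn_gt0 N_gt0.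
rewrite /= muln1 (leq_ltn_trans M_le_N) //.
by rewrite -[X in (X < _)%N]addn0 ltn_add2l (leq_ltn_trans _ iK).
Qed.

Lemma row_scale_sqr (R : realType) (M N K i : nat) :
    (0 < M)%N -> (M <= N)%N ->
  row_scale R M N K i ^+ 2
  = (N%:R + K%:R) / (M%:R * N%:R) - (i < K)%:R / N%:R.
Proof.
move=> M_gt0 M_le_N; have N_gt0 := leq_trans M_gt0 M_le_N.
rewrite row_scaleE sqr_sqrtr ?ltW ?row_scale_radicand_gt0 // mulrBl.
rewrite -[M%:R *+ _]mulr_natr.
by congr (_ - _); rewrite -mulf_div divff ?mul1r // pnatr_eq0 -lt0n.
Qed.

Lemma sum_ltn_ord (A : nzSemiRingType) (M K : nat) :
  (K <= M)%N -> \sum_(i < M) (i < K)%:R = K%:R :> A.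
Proof.
move=> K_le_M; rewrite -natr_sum.
rewrite (eq_bigr (fun i : 'I_M => if (i < K)%N then 1%N else 0%N)); last first.
  by move=> i _; case: ltnP.
by rewrite -big_mkcond (big_ord_narrow K_le_M) sum1_card card_ord.
Qed.

Lemma sum_widen_ord_eq (A : nzSemiRingType) (M K : nat) (K_le_M : (K <= M)%N)
    (i : 'I_M) :
  \sum_(t < K) (i == widen_ord K_le_M t)%:R = (i < K)%:R :> A.
Proof.
case: ltnP => [iK|Ki]; last first.
  apply: big1 => t _; case: eqP => // it; move: Ki.
  by rewrite it leqNgt /= ltn_ord.
rewrite (bigD1 (Ordinal iK)) //= (_ : widen_ord _ _ = i); last exact: val_inj.
rewrite eqxx big1 ?addr0 // => t neq_ti; case: eqP => // it.
by case/eqP: neq_ti; apply: val_inj; rewrite /= it.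
Qed.

(** * The frame *)

Theorem theorem16 (R : realType) (N M K : nat) (N_prime : prime N)
    (M_gt0 : (1 <= M)%N) (M_le_N : (M <= N)%N) (K_le_M : (K <= M)%N)
    (r : 'I_M -> 'I_N) (r_inj : injective r) :
  let H : 'M[R[i]]_(M, N) := rowsub r (dft_mx R N) in
  let D : 'M[R[i]]_M := diag_scaling R M N K in
  let F : 'M[R[i]]_(M, N + K) := row_mx (D *m H) (first_basis R K_le_M) in
  full_spark F /\ unit_norm_tight_frame F.
Proof.
move=> H D F.
have N_gt0 := prime_gt0 N_prime.
have MR_neq0 : M%:R != 0 :> R by rewrite pnatr_eq0 -lt0n.
have NR_neq0 : N%:R != 0 :> R by rewrite pnatr_eq0 -lt0n.
pose a (i : 'I_M) := row_scale R M N K i.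
have a_gt0 i : 0 < a i.
  by rewrite /a row_scaleE sqrtr_gt0 row_scale_radicand_gt0.
have aC_ge0 i : 0 <= (a i)%:C%C by rewrite ler0c ltW.
have spark : full_spark F.
  apply: full_spark_dft_first_basis => // i.
  by rewrite mxE -[_ != _]/((a i)%:C%C != 0) (inj_eq (@complexI R)) gt_eqF.
split=> //.
have w_prim := cis_primitive_root R N N_prime; set w := cis _ in w_prim.
have nw := norm_unity_root N_gt0 (prim_expr_order w_prim).
have Fl i j : F i (lshift K j) = (a i)%:C%C * w ^+ (r i * j).
  by rewrite /F row_mxEl mul_diag_mx !mxE.
have Fr i t : F i (rshift N t) = (i == widen_ord K_le_M t)%:R.
  by rewrite /F row_mxEr !mxE.
have rowF i j : row i F 0 j = F i j by rewrite mxE.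
have colF i j : (col j F)^T 0 i = F i j by rewrite mxE mxE.
have dotE n (u v : 'rV[R[i]]_n) : dotmx u v = \sum_j u 0 j * (v 0 j)^*.
  by rewrite dotmxE mxE; apply: eq_bigr => j _; rewrite !mxE.
have dot_rows i i' : dotmx (row i F) (row i' F) =
    (a i)%:C%C * (a i')%:C%C
      * (\sum_(j < N) w ^+ (r i * j) * (w ^+ (r i' * j))^* )
    + \sum_(t < K) ((i == widen_ord K_le_M t) && (i' == widen_ord K_le_M t))%:R.
  rewrite dotE big_split_ord mulr_sumr; congr (_ + _); apply: eq_bigr => j _.
    by rewrite !rowF !Fl rmorphM /= (CrealP (ger0_real (aC_ge0 i'))) mulrACA.
  by rewrite !rowF !Fr conjC_nat -natrM mulnb.
have norm_w n : w ^+ n * (w ^+ n)^* = 1.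
  by rewrite -normCK normrX nw !expr1n.
split=> [|j|i i' neq_ii'|i i'].
- (* An invertible M x M submatrix, provided by full spark, gives the rank. *)
  have [MNK spark_unit] := spark.
  have widen_inj : injective (widen_ord MNK).
    by move=> i i' /(congr1 val)/= eii'; exact: val_inj.
  apply/eqP; rewrite eqn_leq rank_leq_row.
  rewrite -{1}(mxrank_unit (spark_unit _ widen_inj)).
  by rewrite -[F in colsub _ F]mulmx1 -mulmx_colsub mxrankM_maxl.
- rewrite /norm2 (_ : dotmx _ _ = 1) ?sqrtC1 // dotE.
  case: (split_ordP j) => {}j ->; last first.
    rewrite (bigD1 (widen_ord K_le_M j)) //= !colF Fr eqxx conjC1 mulr1.
    rewrite big1 ?addr0 // => i neq_ij.
    by rewrite !colF Fr (negbTE neq_ij) mul0r.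
  (* M (N + K) / (M N) - K / N = 1 *)
  have -> : 1 = (\sum_(i < M) a i ^+ 2)%:C%C :> R[i].
    under eq_bigr do rewrite row_scale_sqr //.
    rewrite big_split /= sumr_const card_ord sumrN -mulr_suml sum_ltn_ord //.
    congr (_%:C%C); rewrite -[_ *+ M]mulr_natr; field.
    by rewrite NR_neq0 MR_neq0.
  rewrite rmorph_sum; apply: eq_bigr => i _.
  rewrite !colF Fl rmorphM /= (CrealP (ger0_real (aC_ge0 i))) mulrACA norm_w.
  by rewrite mulr1 -expr2 -rmorphXn.
- rewrite dot_rows (prim_root_orthogonal _ _ w_prim) ?(inj_eq r_inj) //.
  rewrite mulr0 add0r big1 // => t _.
  by case: eqP => // it; case: eqP => // i't; case/eqP: neq_ii'; rewrite it i't.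
(* N (N + K) / (M N) = (N + K) / M; in the first K rows the unit entry of the
   basis vector makes up for the smaller scaling. *)
suff dot_row k : dotmx (row k F) (row k F) = ((N%:R + K%:R) / M%:R)%:C%C.
  by rewrite /norm2 !dot_row.
rewrite dot_rows; under eq_bigr do rewrite norm_w.
under [X in _ + X]eq_bigr do rewrite andbb.
rewrite sumr_const card_ord sum_widen_ord_eq -expr2 -rmorphXn row_scale_sqr //.
rewrite -(rmorph_nat (real_complex R)) -rmorphM.
rewrite -(rmorph_nat (real_complex R)) -rmorphD.
by congr (_%:C%C); field; rewrite NR_neq0 MR_neq0.
Qed.
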